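(* Let $\bar x\in M$ be a local minimizer of MPOC at which LICQ holds. Then $\bar x$ is a T-stationary point of MPOC.
   Context: MPOC: minimize $f(x)$ subject to $x\in M=\{x\in\mathbb{R}^n \mid h_i(x)=0,\ i\in I;\ g_j(x)\ge 0,\ j\in J;\ F_{1,m}(x)F_{2,m}(x)=0,\ F_{2,m}(x)\ge 0,\ m=1,\dots,k\}$ with $f,h_i,g_j,F_{1,m},F_{2,m}\in C^2(\mathbb{R}^n,\mathbb{R})$, $I,J$ finite. For $\bar x\in M$: $J_0(\bar x)=\{j\in J\mid g_j(\bar x)=0\}$, $a_{00}(\bar x)=\{m\mid F_{1,m}(\bar x)=0=F_{2,m}(\bar x)\}$, $a_{01}(\bar x)=\{m\mid F_{1,m}(\bar x)=0,F_{2,m}(\bar x)>0\}$, $a_{10}(\bar x)=\{m\mid F_{1,m}(\bar x)\ne0,F_{2,m}(\bar x)=0\}$. LICQ at $\bar x$: the vectors $Dh_i(\bar x)$ ($i\in I$), $Dg_j(\bar x)$ ($j\in J_0(\bar x)$), $DF_{1,m}(\bar x)$ ($m\in a_{01}(\bar x)\cup a_{00}(\bar x)$), $DF_{2,m}(\bar x)$ ($m\in a_{10}(\bar x)\cup a_{00}(\bar x)$) are linearly independent. T-stationarity: $\bar x\in M$ is T-stationary if there are multipliers $\bar\lambda_i$ ($i\in I$), $\bar\mu_j$ ($j\in J_0(\bar x)$), $\bar\sigma_{1,m}$ ($m\in a_{01}(\bar x)$), $\bar\sigma_{2,m}$ ($m\in a_{10}(\bar x)$), $\bar\varrho_{1,m},\bar\varrho_{2,m}$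 ($m\in a_{00}(\bar x)$) with $Df(\bar x)=\sum_{i\in I}\bar\lambda_iDh_i(\bar x)+\sum_{j\in J_0(\bar x)}\bar\mu_jDg_j(\bar x)+\sum_{m\in a_{01}(\bar x)}\bar\sigma_{1,m}DF_{1,m}(\bar x)+\sum_{m\in a_{10}(\bar x)}\bar\sigma_{2,m}DF_{2,m}(\bar x)+\sum_{m\in a_{00}(\bar x)}(\bar\varrho_{1,m}DF_{1,m}(\bar x)+\bar\varrho_{2,m}DF_{2,m}(\bar x))$, $\bar\mu_j\ge0$ for all $j\in J_0(\bar x)$, and for every $m\in a_{00}(\bar x)$: $\bar\varrho_{1,m}=0$ or $\bar\varrho_{2,m}\le 0$. *)

(* Defs.v *)
From HB Require Import structures.
From mathcomp Require Import all_boot all_order all_algebra.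
From mathcomp Require Import all_classical all_reals all_analysis.
Set Implicit Arguments. Unset Strict Implicit. Unset Printing Implicit Defensive.
Import Order.TTheory GRing.Theory Num.Theory.
Import numFieldNormedType.Exports.
Local Open Scope ring_scope.

Section MPOC.
Variables (R : realType) (n : nat).
Notation V := 'rV[R]_n.

Definition evec (i : 'I_n) : V := delta_mx 0 i.

Definition pderiv (f : V -> R) (i : 'I_n) (x : V) : R := 'D_(evec i) f x.

Definition grad (f : V -> R) (x : V) : V := \row_i pderiv f i x.

Definition C1 (f : V -> R) : Prop :=
  (forall x, differentiable f x) /\ (forall i, continuous (pderiv f i)).

Definition C2 (f : V -> R) : Prop := C1 f /\ (forall i, C1 (pderiv f i)).

Variables (p q k : nat).
Variables (h : 'I_p -> V -> R) (g : 'I_q -> V -> R) (F1 F2 : 'I_k -> V -> R).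

Definition feasible (x : V) : Prop :=
  (forall i, h i x = 0) /\ (forall j, 0 <= g j x) /\
  (forall m, F1 m x * F2 m x = 0 /\ 0 <= F2 m x).

Definition J0 (x : V) (j : 'I_q) : bool := g j x == 0.
Definition a00 (x : V) (m : 'I_k) : bool := (F1 m x == 0) && (F2 m x == 0).
Definition a01 (x : V) (m : 'I_k) : bool := (F1 m x == 0) && (0 < F2 m x).
Definition a10 (x : V) (m : 'I_k) : bool := (F1 m x != 0) && (F2 m x == 0).

Definition local_minimizer (f : V -> R) (xb : V) : Prop :=
  feasible xb /\ \forall x \near xb, feasible x -> f xb <= f x.

Definition LICQ (xb : V) : Prop :=
  forall (a : 'I_p -> R) (b : 'I_q -> R) (c d : 'I_k -> R),
    \sum_(i < p) a i *: grad (h i) xb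
    + \sum_(j < q | J0 xb j) b j *: grad (g j) xb
    + \sum_(m < k | a01 xb m || a00 xb m) c m *: grad (F1 m) xb
    + \sum_(m < k | a10 xb m || a00 xb m) d m *: grad (F2 m) xb = 0 ->
    (forall i, a i = 0) /\ (forall j, J0 xb j -> b j = 0) /\
    (forall m, a01 xb m || a00 xb m -> c m = 0) /\
    (forall m, a10 xb m || a00 xb m -> d m = 0).

Definition T_stationary (f : V -> R) (xb : V) : Prop :=
  feasible xb /\
  exists (lam : 'I_p -> R) (mu : 'I_q -> R) (sig1 sig2 rho1 rho2 : 'I_k -> R),
    grad f xb =
      \sum_(i < p) lam i *: grad (h i) xb
      + \sum_(j < q | J0 xb j) mu j *: grad (g j) xb
      + \sum_(m < k | a01 xb m) sig1 m *: grad (F1 m) xb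
      + \sum_(m < k | a10 xb m) sig2 m *: grad (F2 m) xb
      + \sum_(m < k | a00 xb m) (rho1 m *: grad (F1 m) xb + rho2 m *: grad (F2 m) xb)
    /\ (forall j, J0 xb j -> 0 <= mu j)
    /\ (forall m, a00 xb m -> rho1 m = 0 \/ rho2 m <= 0).

End MPOC.

(* Main.v *)
(* Fixing F_{2,m} = 0 for all m in a_00 and forgetting F_{1,m} there leaves, near xb, a
   subset of the feasible set described by equations and by the inequalities g_j >= 0,
   whose gradients at xb are still independent by LICQ. So xb is a local minimizer of an
   ordinary nonlinear program, and its KKT multipliers give T-stationarity with
   rho_{1,m} = 0 for every m in a_00.

   The KKT rule needs no implicit function theorem: minimizing
   f + |x - xb|^2 + N * (squared constraint violation) over small balls gives interior
   critical points arbitrarily close to xb, where the gradient of f + |x - xb|^2 is a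
   combination of the constraint gradients with the right signs. Linear independence at
   xb lets these identities pass to the limit. *)

Require Import Defs.
From HB Require Import structures.
From mathcomp Require Import all_boot all_order all_algebra.
From mathcomp Require Import all_classical all_reals all_analysis.
From mathcomp Require Import ring lra.
Import Order.TTheory GRing.Theory Num.Theory.
Import numFieldNormedType.Exports.
Local Open Scope ring_scope.
Local Open Scope classical_set_scope.

(** * First-order condition at an interior minimum *)

(** If the derivative were nonzero, the difference quotient would keep its sign near [0]; but its
    numerator is nonnegative there, so a step [h] of suitable sign contradicts this. *)
Lemma derive_at_local_min (R : realType) (V : normedModType R) (f : V -> R)
    (x v : V) (df : R) :
  is_derive x v f df -> (\forall y \near x, f x <= f y) -> df = 0.
Proof.
move=> [fxv <-] minx.
have lim_quot : (h^-1 *: (f (h *: v + x) - f x)) @[h --> 0^'] --> 'D_v f x.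
  exact: fxv.
have min_line : \forall h \near (0 : R), f x <= f (h *: v + x).
  have : (h *: v + x) @[h --> (0 : R)] --> 0 *: v + x.
    exact: (cvgD (@scalel_continuous _ _ v _) (cvg_cst _)).
  by rewrite scale0r add0r => /(_ _ minx).
apply/eqP; rewrite eq_le; apply/andP; split; apply/negPn/negP; rewrite -ltNge => d.
- have [e /= e0 He] := filterI (cvgr_gt _ lim_quot _ d) (nbhs_dnbhs min_line).
  have h0 : - (e / 2) < 0 by lra.
  have [] := He (- (e / 2)).
  + by rewrite /ball_ /= sub0r opprK gtr0_norm; lra.
  + by rewrite lt_eqF.
  by rewrite nmulr_rgt0 ?invr_lt0// subr_lt0 => /lt_geF->.
- have [e /= e0 He] := filterI (cvgr_lt _ lim_quot _ d) (nbhs_dnbhs min_line).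
  have h0 : 0 < e / 2 by lra.
  have [] := He (e / 2).
  + by rewrite /ball_ /= sub0r normrN gtr0_norm; lra.
  + by rewrite gt_eqF.
  by rewrite pmulr_rlt0 ?invr_gt0// subr_lt0 => /lt_geF->.
Qed.

(** * Continuity of determinants and adjugates *)

Section MatrixContinuity.
Context {R : realType} {T : topologicalType}.

Lemma continuous_add (f g : T -> R) :
  continuous f -> continuous g -> continuous (fun x => f x + g x).
Proof. by move=> cf cg x; apply: cvgD; [exact: cf | exact: cg]. Qed.

Lemma continuous_mul (f g : T -> R) :
  continuous f -> continuous g -> continuous (fun x => f x * g x).
Proof. by move=> cf cg x; apply: cvgM; [exact: cf | exact: cg]. Qed.

Lemma continuous_sqr (f : T -> R) :
  continuous f -> continuous (fun x => f x ^+ 2).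
Proof. by move=> cf; exact: continuous_mul. Qed.

Lemma continuous_sub (f g : T -> R) :
  continuous f -> continuous g -> continuous (fun x => f x - g x).
Proof. by move=> cf cg x; apply: cvgB; [exact: cf | exact: cg]. Qed.

Lemma continuous_max0 (f : T -> R) :
  continuous f -> continuous (fun x => Num.max (f x) 0).
Proof.
by move=> cf x; apply: (@continuous_max _ _ f (cst 0)); [exact: cf | exact: cvg_cst].
Qed.

Lemma continuous_bigsum (I : Type) (r : seq I) (P : pred I) (f : I -> T -> R) :
  (forall i, continuous (f i)) ->
  continuous (fun x => \sum_(i <- r | P i) f i x).
Proof.
by move=> cf x; apply: cvg_big => [|i _]; [exact: add_continuous | exact: cf].
Qed.

Lemma continuous_bigprod (I : Type) (r : seq I) (P : pred I) (f : I -> T -> R) :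
  (forall i, continuous (f i)) ->
  continuous (fun x => \prod_(i <- r | P i) f i x).
Proof.
by move=> cf x; apply: cvg_big => [|i _]; [exact: mul_continuous | exact: cf].
Qed.

(** Stated entrywise, so that products, determinants and adjugates reduce to finite sums and
    products of real functions. *)
Definition continuous_entries m n (A : T -> 'M[R]_(m, n)) :=
  forall i j, continuous (fun x => A x i j).

Arguments continuous_entries [m n] A.

Lemma continuous_entries_mulmx m n p (A : T -> 'M[R]_(m, n))
    (B : T -> 'M[R]_(n, p)) :
  continuous_entries A -> continuous_entries B ->
  continuous_entries (fun x => A x *m B x).
Proof.
move=> cA cB i j; under eq_fun do rewrite mxE.
by apply: continuous_bigsum => l x; apply: cvgM; [exact: cA | exact: cB].
Qed.

Lemma continuous_det n (A : T -> 'M[R]_n) :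
  continuous_entries A -> continuous (fun x => \det (A x)).
Proof.
move=> cA; apply: continuous_bigsum => s x.
by apply: cvgM; [exact: cvg_cst | apply: continuous_bigprod => i; exact: cA].
Qed.

Lemma continuous_entries_adj n (A : T -> 'M[R]_n) :
  continuous_entries A -> continuous_entries (fun x => \adj (A x)).
Proof.
move=> cA i j; under eq_fun do rewrite mxE.
move=> x; apply: cvgM; first exact: cvg_cst.
apply: continuous_det => k l; under eq_fun do rewrite !mxE.
exact: cA.
Qed.

End MatrixContinuity.
Arguments continuous_entries {R T m n} A.

(** * Compactness of balls and spheres *)

Lemma compact_closed_ball (R : realType) n (x : 'rV[R]_n) (r : R) :
  0 < r -> compact (closed_ball x r).
Proof.
move=> r0; apply: (@bounded_closed_compact R n (closed_ball x r));
  last exact: closed_ball_closed.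
exists (`|x| + r); split; first exact: num_real.
move=> M ltM y /=; rewrite closed_ballE// /closed_ball_ /= => xy.
by rewrite -[y](subKr x) (le_trans (ler_normB _ _))// (le_trans _ (ltW ltM))// lerD2l.
Qed.

Lemma closed_sphere (R : realType) (V : normedModType R) (x : V) (r : R) :
  closed [set y | `|x - y| = r].
Proof.
have -> : [set y | `|x - y| = r] = (fun y => `|x - y|) @^-1` [set r] by [].
apply: closed_comp => [y _|]; last exact: closed_eq.
have sub_cont : {for y, continuous (fun z => x - z)}.
  by apply: cvgB; [exact: cvg_cst | exact: cvg_id].
exact: (continuous_comp sub_cont (@norm_continuous _ V _)).
Qed.

Lemma compact_sphere (R : realType) n (x : 'rV[R]_n) (r : R) :
  0 < r -> compact [set y | `|x - y| = r].
Proof.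
move=> r0.
apply: (@subclosed_compact _ _ (closed_ball x r) _ (compact_closed_ball R n x r r0)).
  exact: closed_sphere.
by move=> y /= xy; rewrite closed_ballE// /closed_ball_ /= xy.
Qed.

Lemma is_derive_coord (R : realType) n (l : 'I_n) (x v : 'rV[R]_n) :
  is_derive x v (fun y => y 0 l) (v 0 l).
Proof.
apply: DeriveDef; first exact/diff_derivable/differentiable_coord.
apply: cvg_lim => //; apply: cvg_near_cst.
near=> t; rewrite /= !mxE addrK -[_ *: _]/(_ * _) mulKf//.
by near: t; exact: nbhs_dnbhs_neq.
Unshelve. all: by end_near. Qed.

(** * The penalty method: approximate multipliers near [xb] *)

Section Penalty.
Context {R : realType} {n r : nat}.
Variables (f : 'rV[R]_n -> R) (G : 'I_r -> 'rV[R]_n -> R) (ineq : pred 'I_r).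
Variable xb : 'rV[R]_n.
Hypothesis df : forall x, differentiable f x.
Hypothesis dG : forall i x, differentiable (G i) x.

Definition admissible (x : 'rV[R]_n) :=
  forall i, if ineq i then 0 <= G i x else G i x == 0.

(** The projection of [s] onto the allowed values of the constraint, [[0, +oo)] or [{0}]. *)
Definition nearest_value i (s : R) := if ineq i then Num.max s 0 else 0.

Lemma nearest_valueP i s s' :
  (s - nearest_value i s) ^+ 2 <= (s - nearest_value i s') ^+ 2.
Proof.
rewrite /nearest_value; case: (ineq i) => //.
have [s0|s0] := leP s 0; last by rewrite subrr expr0n sqr_ge0.
have : 0 <= Num.max s' 0 by rewrite le_max lexx orbT.
by move: (Num.max s' 0) => t t0; nra.
Qed.

(** The added term makes [xb] a strict local minimizer. It is a sum of squared coordinates because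
    the norm on row vectors is the sup norm, which is not smooth. *)
Definition proximal x := f x + \sum_(l < n) (x 0 l - xb 0 l) ^+ 2.

Definition violation x := \sum_(i < r) (G i x - nearest_value i (G i x)) ^+ 2.

(* Freezing [nearest_value] at the values of a point [c] gives a smooth majorant of
   [violation] that agrees with it at [c], so that a minimizer of the penalized
   function also minimizes the smooth one: [Num.max] is never differentiated. *)
Definition frozen_violation (t : 'I_r -> R) x := \sum_(i < r) (G i x - t i) ^+ 2.

Lemma violation_ge0 x : 0 <= violation x.
Proof. by apply: sumr_ge0 => i _; exact: sqr_ge0. Qed.

Lemma violation_eq0 x : violation x = 0 -> admissible x.
Proof.
move=> /eqP; rewrite psumr_eq0 => [/allP v0 i|i _]; last exact: sqr_ge0.
have := v0 i (mem_index_enum _); rewrite /= sqrf_eq0 subr_eq0 /nearest_value.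
by case: (ineq i) => /eqP // ->; rewrite le_max lexx orbT.
Qed.

Lemma proximal_gt x : f xb <= f x -> x != xb -> f xb < proximal x.
Proof.
move=> fle neq; rewrite /proximal ltr_pwDr//.
rewrite lt_def; apply/andP; split; last first.
  by apply: sumr_ge0 => l _; exact: sqr_ge0.
apply: contra neq; rewrite psumr_eq0 => [/allP v0|l _]; last exact: sqr_ge0.
apply/eqP/rowP => l; apply/eqP; rewrite -subr_eq0 -sqrf_eq0.
exact: v0 (mem_index_enum _).
Qed.

Lemma continuous_proximal : continuous proximal.
Proof.
apply: continuous_add => [x|]; first exact: (differentiable_continuous (df x)).
apply: continuous_bigsum => l; apply: continuous_sqr; apply: continuous_sub.
  exact: coord_continuous.
exact: cst_continuous.
Qed.

Lemma continuous_violation : continuous violation.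
Proof.
apply: continuous_bigsum => i; apply: continuous_sqr.
have cG : continuous (G i) by move=> x; exact: (differentiable_continuous (dG i x)).
apply: continuous_sub => //; rewrite /nearest_value.
by case: (ineq i); [exact: continuous_max0 | exact: cst_continuous].
Qed.

Lemma is_derive_frozen_penalty (t : 'I_r -> R) (N : R) (l : 'I_n) x :
  is_derive x (evec R l) (fun y => proximal y + N * frozen_violation t y)
    (pderiv f l x + 2 * (x 0 l - xb 0 l)
     + N * \sum_(i < r) 2 * (G i x - t i) * pderiv (G i) l x).
Proof.
pose e := evec R l.
have derive_sqr (F : 'rV[R]_n -> R) (a dF : R) : is_derive x e F dF ->
    is_derive x e (fun y => (F y - a) ^+ 2) (2 * (F x - a) * dF).
  move=> FdF; have -> : dF = dF - 0 by rewrite subr0.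
  exact: (is_deriveX 2 (is_deriveB FdF (is_derive_cst a x e))).
have derive_sum m (F : 'I_m -> 'rV[R]_n -> R) (dF : 'I_m -> R) :
    (forall i, is_derive x e (F i) (dF i)) ->
    is_derive x e (fun y => \sum_(i < m) F i y) (\sum_(i < m) dF i).
  move=> FdF; have -> : (fun y => \sum_(i < m) F i y) = \sum_(i < m) F i.
    by apply/funext => y; rewrite fct_sumE.
  exact: is_derive_sum.
have deriv (F : 'rV[R]_n -> R) : differentiable F x -> is_derive x e F (pderiv F l x).
  by move=> dF; apply: DeriveDef => //; exact/diff_derivable.
have -> : 2 * (x 0 l - xb 0 l)
    = \sum_(j < n) 2 * (x 0 j - xb 0 j) * e 0 j.
  rewrite (bigD1 l)//= big1 => [|j jl]; rewrite !mxE eqxx/= ?eqxx ?mulr1 ?addr0//.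
  by rewrite (negbTE jl) mulr0.
apply: is_deriveD; first apply: is_deriveD; first exact: deriv.
  by apply: derive_sum => j; apply: derive_sqr; exact: is_derive_coord.
apply: is_deriveZ; apply: derive_sum => i; apply: derive_sqr; exact: deriv.
Qed.

(* Near a point of the sphere, either [violation] is bounded away from [0] and the
   penalty wins for large [N], or the point is admissible and [proximal] exceeds
   [f xb]; compactness makes [N] uniform. *)
Lemma penalty_gt_on_sphere (e : R) : 0 < e ->
  (forall x, `|xb - x| = e -> admissible x -> f xb <= f x) ->
  \forall N \near +oo, forall x, `|xb - x| = e ->
    f xb < proximal x + N * violation x.
Proof.
move=> e0 minf.
have cS := proj1 (compact_near_coveringP _) (compact_sphere _ _ xb _ e0).
apply: (cS R (+oo)
  (fun N x => f xb < proximal x + N * violation x)) => x /= xe.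
have := violation_ge0 x; rewrite le_eqVlt => /predU1P[/esym v0|v0].
  have prox : f xb < proximal x.
    apply: proximal_gt; first exact: minf (violation_eq0 _ v0).
    by apply/eqP => xxb; move: xe e0; rewrite xxb subrr normr0 => <-; rewrite ltxx.
  exists ([set y | f xb < proximal y], [set N | 0 < N]).
    split; last exact: nbhs_pinfty_gt.
    exact: (cvgr_gt _ (continuous_proximal x) _ prox).
  move=> [y N] [/= py N0]; rewrite ltr_wpDr// mulr_ge0 ?violation_ge0//.
  exact: ltW.
(* Above this threshold, [N * (violation x / 2)] exceeds [f xb - proximal x + 1], which absorbs the
   losses allowed to [y]. The maximum with [0] makes [N] positive. *)
exists ([set y | proximal x - 1 < proximal y /\ violation x / 2 < violation y],
  [set N | Num.max 0 ((f xb - proximal x + 1) / (violation x / 2)) < N]).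
  split; last by apply: nbhs_pinfty_gt; exact: num_real.
  apply: filterI.
    by apply: (cvgr_gt _ (continuous_proximal x)); lra.
  by apply: (cvgr_gt _ (continuous_violation x)); lra.
move=> [y N] [/= [py vy]]; rewrite gt_max => /andP[N0].
have v2 : 0 < violation x / 2 by lra.
by rewrite ltr_pdivrMr// => HN; nra.
Qed.

Lemma penalized_stationarity (U : set 'rV[R]_n) :
  (forall i, G i xb = 0) ->
  (\forall x \near xb, admissible x -> f xb <= f x) ->
  nbhs xb U ->
  exists x (lam : 'rV[R]_r), [/\ U x, forall i, ineq i -> 0 <= lam 0 i &
    grad f x + 2 *: (x - xb) = \sum_(i < r) lam 0 i *: grad (G i) x].
Proof.
move=> Gxb minf nU.
have [e0 /= e00 He0] := proj1 (nbhs_ballP _ _) (filterI minf nU).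
(* Halving keeps the closed ball inside the open one where [minf] and [U] are available. *)
pose e := e0 / 2; have e_gt0 : 0 < e by rewrite /e; lra.
have He x : `|xb - x| <= e -> (admissible x -> f xb <= f x) /\ U x.
  by move=> xe; apply: He0; rewrite -ball_normE /ball_ /=; rewrite /e in xe; lra.
have minS x : `|xb - x| = e -> admissible x -> f xb <= f x.
  by move=> xe; apply: (He x _).1; rewrite xe.
have [N [N0 HN]] : exists N : R, 0 < N /\ forall x, `|xb - x| = e ->
    f xb < proximal x + N * violation x.
  have near_N : \forall N \near (+oo : set_system R),
      0 < N /\ forall x, `|xb - x| = e -> f xb < proximal x + N * violation x.
    apply: filterI; first exact: nbhs_pinfty_gt.
    exact: penalty_gt_on_sphere.
  by have [N HN] := filter_ex near_N; exists N.
pose phi x := proximal x + N * violation x.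
have cphi : continuous phi.
  apply: continuous_add; first exact: continuous_proximal.
  by apply: continuous_mul; [exact: cst_continuous | exact: continuous_violation].
have [c /set_mem ce minc] : exists2 c, c \in closed_ball xb e &
    forall t, t \in closed_ball xb e -> phi c <= phi t.
  apply: EVT_min_rV; [|exact: compact_closed_ball|exact: continuous_subspaceT].
  by exists xb; exact: closed_ballxx.
have minc' y : `|xb - y| <= e -> phi c <= phi y.
  by move=> ye; apply: minc; rewrite inE closed_ballE.
have phixb : phi xb = f xb.
  rewrite /phi /proximal /violation !big1 ?mulr0 ?addr0// => [i _|l _].
    by rewrite /nearest_value Gxb maxxx if_same subrr expr0n.
  by rewrite subrr expr0n.
have c_le : `|xb - c| <= e by move: ce; rewrite closed_ballE.
have c_lt : `|xb - c| < e.
  rewrite lt_neqAle c_le andbT; apply/eqP => /HN; apply/negP; rewrite -leNgt.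
  by rewrite -phixb; apply: minc'; rewrite subrr normr0 ltW.
pose t i := nearest_value i (G i c).
have minpsi : \forall y \near c,
    proximal c + N * frozen_violation t c <= proximal y + N * frozen_violation t y.
  have : ball c (e - `|xb - c|) `<=` [set y | `|xb - y| <= e].
    move=> y; rewrite -ball_normE /ball_ /= => cy.
    by rewrite -(subrK c xb) -addrA (le_trans (ler_normD _ _))//; lra.
  move=> sub; have : nbhs c (ball c (e - `|xb - c|)).
    by apply: nbhsx_ballx; rewrite subr_gt0.
  apply: filterS => y /sub/= ye; apply: (le_trans (minc' _ ye)).
  rewrite lerD2l ler_pM2l//; apply: ler_sum => i _; exact: nearest_valueP.
(* The multipliers are minus the coefficients of the constraint gradients in the derivative of the
   penalty. For an inequality, [t i] is at least [G i c], which gives the sign. *)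
exists c, (\row_i (- (N * (2 * (G i c - t i))))); split.
- exact: (He c c_le).2.
- move=> i ii; rewrite mxE oppr_ge0 pmulr_rle0// pmulr_rle0// subr_le0 /t.
  by rewrite /nearest_value ii le_max lexx.
apply/rowP => l.
have /(congr1 (fun s => s - N * \sum_(i < r) 2 * (G i c - t i) * pderiv (G i) l c)) :=
  derive_at_local_min _ _ _ _ _ _ (is_derive_frozen_penalty t N l c) minpsi.
rewrite addrK sub0r !mxE => ->; rewrite summxE mulr_sumr -sumrN.
by apply: eq_bigr => i _; rewrite !mxE; ring.
Qed.

End Penalty.

(** * Passage to the limit and the KKT rule *)

Lemma nonneg_of_frequently (R : realType) (T : topologicalType) (u : T -> R)
    (x : T) :
  {for x, continuous u} -> (forall U, nbhs x U -> exists2 y, U y & 0 <= u y) ->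
  0 <= u x.
Proof.
move=> cu freq; rewrite leNgt; apply/negP => ux0.
by have [y /= /lt_geF->] := freq _ (cvgr_lt _ cu _ ux0).
Qed.

Lemma near_forall_gt0 (R : realType) (V : normedModType R) (I : finType)
    (P : pred I) (u : I -> V -> R) (x : V) :
  (forall i, differentiable (u i) x) -> (forall i, P i -> 0 < u i x) ->
  \forall y \near x, forall i, P i -> 0 < u i y.
Proof.
move=> du u0; apply: filter_forall => i; have [Pi|/negP nPi] := boolP (P i).
  have near_u : \forall y \near x, 0 < u i y.
    exact: (cvgr_gt _ (differentiable_continuous (du i)) _ (u0 i Pi)).
  exact: (filterS (fun y (uy : 0 < u i y) _ => uy) near_u).
exact: nearW.
Qed.

(* Penalty points give the multiplier rule arbitrarily close to [xb]. With [B] a right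
   inverse of the Jacobian [A xb], the multipliers there are, up to the factor
   [\det (A x *m B)], the polynomial expression [L x] in the derivatives, so the rule
   and the signs pass to the limit without extracting convergent multipliers. *)
Lemma KKT_linearly_independent (R : realType) (n r : nat) (f : 'rV[R]_n -> R)
    (G : 'I_r -> 'rV[R]_n -> R) (ineq : pred 'I_r) (xb : 'rV[R]_n) :
  C1 f -> (forall i, C1 (G i)) -> (forall i, G i xb = 0) ->
  (\forall x \near xb, admissible G ineq x -> f xb <= f x) ->
  (forall a : 'I_r -> R, \sum_(i < r) a i *: grad (G i) xb = 0 ->
     forall i, a i = 0) ->
  exists2 lam : 'I_r -> R, grad f xb = \sum_(i < r) lam i *: grad (G i) xb &
    forall i, ineq i -> 0 <= lam i.
Proof.
move=> [df cf] C1G Gxb minf indep.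
pose A x := \matrix_(i < r, l < n) pderiv (G i) l x.
have sumA (u : 'rV[R]_r) x : \sum_(i < r) u 0 i *: grad (G i) x = u *m A x.
  rewrite mulmx_sum_row; apply: eq_bigr => i _; congr (_ *: _).
  by apply/rowP => l; rewrite !mxE.
(* Independence of the gradients means that the Jacobian has trivial left kernel, hence full row
   rank. *)
have [B AB1] : exists B, A xb *m B = 1%:M.
  apply/row_freeP; rewrite -kermx_eq0; apply/eqP/row_matrixP => j.
  rewrite row0; apply/rowP => i; rewrite [RHS]mxE.
  apply: (indep (fun i => row j (kermx (A xb)) 0 i)).
  by rewrite sumA -row_mul mulmx_ker row0.
pose y x := grad f x + 2 *: (x - xb).
pose M x := A x *m B.
pose L x := y x *m B *m \adj (M x).
(* The residual of the multiplier rule, cleared of the denominator [\det (M x)]. This determinant is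
   [1] at [xb], so [E xb = 0] is the rule sought. *)
pose E x := \det (M x) *: y x - L x *m A x.
have cA : continuous_entries A.
  by move=> i l; under eq_fun do rewrite mxE; exact: (C1G i).2.
have cy : continuous_entries y.
  move=> i l; under eq_fun do rewrite !mxE.
  apply: continuous_add; first exact: cf.
  apply: continuous_mul; first exact: cst_continuous.
  by apply: continuous_sub; [exact: coord_continuous | exact: cst_continuous].
have cB : continuous_entries (fun _ : 'rV[R]_n => B).
  by move=> i l; exact: cst_continuous.
have cM : continuous_entries M by exact: continuous_entries_mulmx.
have cL : continuous_entries L.
  apply: continuous_entries_mulmx; first exact: continuous_entries_mulmx.
  exact: continuous_entries_adj.
have cE : continuous_entries E.
  have cLA := continuous_entries_mulmx _ _ _ _ _ cL cA.
  move=> i l; rewrite (_ : (fun x => E x i l) =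
      fun x => \det (M x) * y x i l - (L x *m A x) i l).
    apply: continuous_sub; last exact: cLA.
    by apply: continuous_mul; [exact: continuous_det | exact: cy].
  by apply/funext => x; rewrite /E [LHS]mxE [in LHS]mxE [X in _ + X]mxE.
have detM : \det (M xb) = 1 by rewrite /M AB1 det1.
have freq (U : set 'rV[R]_n) : nbhs xb U -> exists2 x, U x &
    E x = 0 /\ forall i, ineq i -> 0 <= L x 0 i.
  move=> nU.
  (* Positivity of the determinant lets [L x], which is [\det (M x)] times the multipliers, inherit
     their signs. *)
  have det_pos : \forall x \near xb, 0 < \det (M x).
    have cdet := continuous_det _ _ cM.
    by apply: (cvgr_gt _ (cdet xb)); rewrite detM.
  have [x [lam [[Ux /= dx] lam0]]] := penalized_stationarity f G ineq xb df
    (fun i => (C1G i).1) _ Gxb minf (filterI nU det_pos).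
  rewrite sumA -/(y x) => ylam.
  have Llam : L x = \det (M x) *: lam.
    by rewrite /L ylam -(mulmxA lam) -/(M x) -mulmxA mul_mx_adj mul_mx_scalar.
  exists x => //; split => [|i ii]; last by rewrite Llam mxE mulr_ge0 ?lam0// ltW.
  by rewrite /E Llam ylam scalemxAl subrr.
exists (fun i => L xb 0 i) => [|i ii]; last first.
  apply: (nonneg_of_frequently _ _ (fun x => L x 0 i) xb (cL 0 i xb)).
  by move=> U /freq[x Ux [_ Lx]]; exists x => //; exact: Lx.
(* Each entry of [E] vanishes at points arbitrarily close to [xb], so the sign lemma applies to it
   and to its opposite. *)
have E0 : E xb = 0.
  apply/rowP => l; rewrite [RHS]mxE; apply/eqP; rewrite eq_le -oppr_ge0; apply/andP; split.
    apply: (nonneg_of_frequently _ _ (fun x => - E x 0 l) xb).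
      exact: (cvgN (cE 0 l xb)).
    by move=> U /freq[x Ux [Ex _]]; exists x => //; rewrite Ex mxE oppr0.
  apply: (nonneg_of_frequently _ _ (fun x => E x 0 l) xb (cE 0 l xb)).
  by move=> U /freq[x Ux [Ex _]]; exists x => //; rewrite Ex mxE.
rewrite sumA; apply/eqP; rewrite -subr_eq0 -[X in _ == X]E0 /E detM scale1r.
by rewrite /y subrr scaler0 addr0.
Qed.

Lemma KKT_linearly_independent_in (R : realType) (n : nat) (I : finType)
    (f : 'rV[R]_n -> R) (G : I -> 'rV[R]_n -> R) (act ineq : pred I)
    (xb : 'rV[R]_n) :
  C1 f -> (forall i, C1 (G i)) -> (forall i, act i -> G i xb = 0) ->
  (\forall x \near xb,
     (forall i, act i -> if ineq i then 0 <= G i x else G i x == 0) ->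
     f xb <= f x) ->
  (forall a : I -> R, \sum_(i | act i) a i *: grad (G i) xb = 0 ->
     forall i, act i -> a i = 0) ->
  exists2 lam : I -> R, grad f xb = \sum_(i | act i) lam i *: grad (G i) xb &
    forall i, act i -> ineq i -> 0 <= lam i.
Proof.
move=> C1f C1G Gxb minf indep.
pose v (j : 'I_#|act|) := enum_val j.
have actv j : act (v j) by exact: (enum_valP j).
have vP i : act i -> exists j, i = v j.
  by move=> ai; exists (enum_rank_in ai i); rewrite /v enum_rankK_in.
have sumv (F : I -> 'rV[R]_n) : \sum_(i | act i) F i = \sum_j F (v j).
  exact: (big_enum_val F).
have [||||lam lamE lam0] := KKT_linearly_independent R n #|act| f
    (fun j => G (v j)) (fun j => ineq (v j)) xb C1f.
- by move=> j; exact: C1G.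
- by move=> j; exact: Gxb.
- apply: filterS minf => x minx adm; apply: minx => i /vP[j ->]; exact: adm.
(* Extension of [a] by zero off the active indices: [v] is injective, so the sum has at most one
   term. *)
- move=> a a0 j; pose b i := \sum_(j | v j == i) a j.
  have bv k : b (v k) = a k.
    rewrite /b (big_pred1 k)// => l; apply/eqP/eqP => [|->//]; exact: enum_val_inj.
  rewrite -bv; apply: indep => //; rewrite sumv -[RHS]a0.
  by apply: eq_bigr => k _; rewrite bv.
pose b i := \sum_(j | v j == i) lam j.
have bv k : b (v k) = lam k.
  rewrite /b (big_pred1 k)// => l; apply/eqP/eqP => [|->//]; exact: enum_val_inj.
exists b => [|i /vP[j ->] ij]; last by rewrite bv lam0.
by rewrite sumv lamE; apply: eq_bigr => k _; rewrite bv.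
Qed.

(** * Reduction of MPOC to a nonlinear program *)

Theorem mainTheorem3 (R : realType) (n p q k : nat)
  (f : 'rV[R]_n -> R) (h : 'I_p -> 'rV[R]_n -> R) (g : 'I_q -> 'rV[R]_n -> R)
  (F1 F2 : 'I_k -> 'rV[R]_n -> R) (xb : 'rV[R]_n) :
  C2 f -> (forall i, C2 (h i)) -> (forall j, C2 (g j)) ->
  (forall m, C2 (F1 m)) -> (forall m, C2 (F2 m)) ->
  local_minimizer h g F1 F2 f xb ->
  LICQ h g F1 F2 xb ->
  T_stationary h g F1 F2 f xb.
Proof.
move=> C2f C2h C2g C2F1 C2F2 [feas minf] licq; split=> //.
have [hxb [gxb Fxb]] := feas.
pose I : finType := ('I_p + ('I_q + ('I_k + 'I_k)))%type.
pose G (s : I) := match s with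
  | inl i => h i | inr (inl j) => g j
  | inr (inr (inl m)) => F1 m | inr (inr (inr m)) => F2 m end.
pose act : pred I := fun s => match s with
  | inl i => true | inr (inl j) => J0 g xb j
  | inr (inr (inl m)) => a01 F1 F2 xb m
  | inr (inr (inr m)) => a10 F1 F2 xb m || a00 F1 F2 xb m end.
pose ineq : pred I := fun s => if s is inr (inl _) then true else false.
have C1G s : C1 (G s).
  by case: s => [i|[j|[m|m]]]; [have [] := C2h i | have [] := C2g j
    | have [] := C2F1 m | have [] := C2F2 m].
have sumI (F : I -> 'rV[R]_n) : \sum_(s | act s) F s =
    \sum_(i < p) F (inl i) + \sum_(j < q | J0 g xb j) F (inr (inl j))
    + \sum_(m < k | a01 F1 F2 xb m) F (inr (inr (inl m)))
    + \sum_(m < k | a10 F1 F2 xb m || a00 F1 F2 xb m) F (inr (inr (inr m))).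
  by rewrite !big_sumType /= !addrA.
have classify m : [|| a01 F1 F2 xb m, a10 F1 F2 xb m | a00 F1 F2 xb m].
  have [/eqP FF F2ge] := Fxb m; rewrite /a01 /a10 /a00.
  move: FF F2ge; rewrite mulf_eq0 le_eqVlt [0 == _]eq_sym.
  by case: (F1 m xb == 0); case: (F2 m xb == 0); case: (0 < F2 m xb).
(* Constraints strict at [xb] stay strict nearby, so they may be left out of [act]. *)
have g_near : \forall x \near xb, forall j, ~~ J0 g xb j -> 0 < g j x.
  apply: (near_forall_gt0 R _ _ (fun j => ~~ J0 g xb j) g xb) => j.
    exact: (C2g j).1.1.
  by move=> j0; rewrite lt_def gxb andbT.
have F2_near : \forall x \near xb, forall m, a01 F1 F2 xb m -> 0 < F2 m x.
  apply: (near_forall_gt0 R _ _ (a01 F1 F2 xb) F2 xb) => m.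
    exact: (C2F2 m).1.1.
  by case/andP.
have [|||||lam lamE lam0] := KKT_linearly_independent_in R n I f G act ineq xb.
- by case: C2f.
- exact: C1G.
- case=> [i|[j|[m|m]]] /=; first by rewrite hxb.
  + by move/eqP.
  + by case/andP => /eqP.
  + by case/orP => /andP[_ /eqP].
- near=> x => adm.
  have minx : feasible h g F1 F2 x -> f xb <= f x by near: x.
  have gx : forall j, ~~ J0 g xb j -> 0 < g j x by near: x.
  have F2x : forall m, a01 F1 F2 xb m -> 0 < F2 m x by near: x.
  apply: minx; split; [|split].
  + by move=> i; apply/eqP; exact: (adm (inl i)).
  + move=> j; have [j0|/gx/ltW//] := boolP (J0 g xb j).
    exact: (adm (inr (inl j)) j0).
  + move=> m; have [m01|m01] := boolP (a01 F1 F2 xb m).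
      have F1x : F1 m x = 0 by apply/eqP; exact: (adm (inr (inr (inl m))) m01).
      by rewrite F1x mul0r; split=> //; exact/ltW/F2x.
    have m2 : a10 F1 F2 xb m || a00 F1 F2 xb m.
      by have := classify m; rewrite (negbTE m01).
    have F2x0 : F2 m x = 0 by apply/eqP; exact: (adm (inr (inr (inr m))) m2).
    by rewrite F2x0 mulr0.
- move=> a; rewrite sumI => a0.
  (* LICQ also involves the [F1] gradients on [a00], absent from the program: they get coefficient
     zero. *)
  pose c m := if a01 F1 F2 xb m then a (inr (inr (inl m))) else 0.
  have [|ha [ga [ca da]]] := licq (fun i => a (inl i))
    (fun j => a (inr (inl j))) c (fun m => a (inr (inr (inr m)))).
    rewrite -[RHS]a0; congr (_ + _ + _).
    rewrite big_mkcond [RHS]big_mkcond; apply: eq_bigr => m _; rewrite /c /=.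
    by case: (a01 F1 F2 xb m) => //=; rewrite scale0r if_same.
  case=> [i|[j|[m|m]]] /= si.
  + exact: ha.
  + exact: ga.
  + by have := ca m; rewrite /c si; apply.
  + exact: da.
exists (fun i => lam (inl i)), (fun j => lam (inr (inl j))),
  (fun m => lam (inr (inr (inl m)))), (fun m => lam (inr (inr (inr m)))),
  (fun=> 0), (fun m => lam (inr (inr (inr m)))); split; last first.
  by split => [j j0|m _]; [exact: (lam0 (inr (inl j))) | left].
rewrite lamE sumI -!addrA; do 3 congr (_ + _).
under [X in _ + X]eq_bigr do rewrite scale0r add0r.
(* [a10] and [a00] are disjoint, so the single sum of [F2] terms splits into the [sig2] and [rho2]
   parts. *)
rewrite big_mkcond [X in X + _]big_mkcond [X in _ + X]big_mkcond -big_split/=.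
apply: eq_bigr => m _; rewrite /a10 /a00.
by case: (F1 m xb == 0); case: (F2 m xb == 0) => /=; rewrite ?addr0 ?add0r.
Unshelve. all: by end_near.
Qed.
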